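(* Let $R$ and $S$ be TRSs over $\Sigma$ and $T\subseteq\mathcal{T}(\Sigma,\emptyset)$. Then $R$ is terminating relative to $S$ on $T$ if and only if there is an extended well-founded monotone partial $\Sigma$-algebra $(A,[\![\cdot]\!],\succ,\sqsupseteq)$ such that $T$ is defined (i.e. $[\![t]\!]$ is defined for all $t\in T$), $\succ$ is a partial model for $R$, and $\sqsupseteq$ is a partial model for $S$.
   Context: A TRS over $\Sigma$ is a set of rules $\ell\to r$ ($\ell\notin\mathcal{X}$, $\mathrm{Var}(r)\subseteq\mathrm{Var}(\ell)$) with usual one-step rewrite relation $\to_R$. For relations $\to_1,\to_2$ on a set $A$, $\to_1$ is terminating relative to $\to_2$ on $B\subseteq A$ if $\to_2^*\cdot\to_1\cdot\to_2^*$ admits no infinite sequence starting in $B$. $R$ is terminating relative to $S$ on $T$ if $\to_R$ is terminating relative to $\to_S$ on $T$. A partial $\Sigma$-algebra $(A,[\![\cdot]\!])$: non-empty $A$, partial functions $[\![f]\!]:A^n\rightharpoonup A$; term interpretation under $\alpha:\mathcal{X}\to A$: $[\![x]\!]_\alpha=\alpha(x)$, $[\![f(t_1,\dots,t_n)]\!]_\alpha=[\![f]\!]([\![t_1]\!]_\alpha,\dots,[\![t_n]\!]_\alpha)$, defined only if all subexpressions are; $[\![t]\!]$ for ground $t$. A partial function is closed w.r.t. relation $\rho$ if $f(\dots,a,\dots)$ defined and $a\,\rho\,b$ imply $f(\dots,b,\dots)$ defined; monotone w.r.t. $\rho$ if $f(\dots,a,\dots)$, $f(\dots,b,\dots)$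 defined and $a\,\rho\,b$ imply $f(\dots,a,\dots)\,\rho\,f(\dots,b,\dots)$ (all positions). An extended well-founded monotone partial $\Sigma$-algebra $(A,[\![\cdot]\!],\succ,\sqsupseteq)$ is a partial $\Sigma$-algebra with relations $\succ,\sqsupseteq$ on $A$ such that every $[\![f]\!]$ is closed and monotone w.r.t. both $\succ$ and $\sqsupseteq$, and $\succ$ is terminating relative to $\sqsupseteq$ on $A$. A relation $\rho$ is a partial model for a TRS $R$ if for all $\ell\to r\in R$ and $\alpha:\mathrm{Var}(\ell)\to A$ with $[\![\ell]\!]_\alpha$ defined, $[\![\ell]\!]_\alpha\,\rho\,[\![r]\!]_\alpha$. *)

(* Defs.v *)
From mathcomp Require Import all_boot.
From mathcomp Require Import boolp classical_sets.
From Stdlib Require Import Relations.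

Set Implicit Arguments.
Unset Strict Implicit.
Unset Printing Implicit Defensive.

Local Open Scope classical_set_scope.

Record signature := Signature { symbol :> Type; arity : symbol -> nat }.

Section Terms.
Variables (Sigma : signature) (X : Type).

(* An n-tuple of arguments is a function on 'I_n. *)
Inductive term : Type :=
  | Var (x : X)
  | App (f : Sigma) (ts : 'I_(arity f) -> term).

Fixpoint vars (t : term) : set X :=
  match t with
  | Var x => [set x]
  | App f ts => \bigcup_(i in [set: 'I_(arity f)]) vars (ts i)
  end.

Definition is_var (t : term) : Prop := exists x, t = Var x.

(* The set T(Sigma, empty), as a subset of T(Sigma, X). *)
Definition ground : set term := [set t | vars t = set0].

Fixpoint subst (sigma : X -> term) (t : term) : term :=
  match t with
  | Var x => sigma x
  | App f ts => App (fun i => subst sigma (ts i))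
  end.

Record rule := Rule {
  lhs : term;
  rhs : term;
  lhs_nvar : ~ is_var lhs;
  rhs_vars : vars rhs `<=` vars lhs }.

Definition TRS := set rule.

End Terms.

Arguments Var {Sigma X} x.
Arguments App {Sigma X} f ts.
Arguments ground {Sigma X}.

(* (..., a_i, ...) with the i-th component replaced by b. *)
Definition upd (A : Type) (n : nat) (a : 'I_n -> A) (i : 'I_n) (b : A) :
  'I_n -> A := fun j => if j == i then b else a j.

Inductive rewrite_step (Sigma : signature) (X : Type) (R : TRS Sigma X) :
    term Sigma X -> term Sigma X -> Prop :=
  | rewrite_root (rl : rule Sigma X) (sigma : X -> term Sigma X) :
      R rl -> rewrite_step R (subst sigma (lhs rl)) (subst sigma (rhs rl))
  | rewrite_arg (f : Sigma) (ts : 'I_(arity f) -> term Sigma X)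
      (i : 'I_(arity f)) (u : term Sigma X) :
      rewrite_step R (ts i) u -> rewrite_step R (App f ts) (App f (upd ts i u)).

(* ->_2^* . ->_1 . ->_2^* *)
Definition relative_step (A : Type) (r1 r2 : relation A) : relation A :=
  fun a d => exists b c,
    [/\ clos_refl_trans A r2 a b, r1 b c & clos_refl_trans A r2 c d].

Definition relatively_terminating_on (A : Type) (r1 r2 : relation A)
    (B : set A) : Prop :=
  ~ exists s : nat -> A,
      B (s 0) /\ forall n, relative_step r1 r2 (s n) (s n.+1).

Record partial_algebra (Sigma : signature) := PartialAlgebra {
  carrier :> Type;
  carrier_nonempty : inhabited carrier;
  op : forall f : Sigma, ('I_(arity f) -> carrier) -> option carrier }.

Section Interpretation.
Variables (Sigma : signature) (X : Type) (A : partial_algebra Sigma).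

(* The graph of the partial map t |-> [[t]]_alpha: [interp alpha t a] says that
   [[t]]_alpha is defined and equal to a. *)
Inductive interp (alpha : X -> A) : term Sigma X -> A -> Prop :=
  | interp_Var (x : X) : interp alpha (Var x) (alpha x)
  | interp_App (f : Sigma) (ts : 'I_(arity f) -> term Sigma X)
      (a : 'I_(arity f) -> A) (b : A) :
      (forall i, interp alpha (ts i) (a i)) -> op a = Some b ->
      interp alpha (App f ts) b.

Lemma interp_functional (alpha : X -> A) (t : term Sigma X) (a b : A) :
  interp alpha t a -> interp alpha t b -> a = b.
Proof.
move=> ta; elim: ta b => {t a} [x|f ts a c _ IH opa] b tb.
  exact: (match tb in interp _ t b' return
            match t with Var x => alpha x = b' | _ => True end
          with interp_Var _ => erefl | interp_App _ _ _ _ _ _ => I end).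
suff [a' tsa' opa'] : exists2 a' : 'I_(arity f) -> A,
    forall i, interp alpha (ts i) (a' i) & op a' = Some b.
  have aa' : a = a' by apply: funext => i; exact: IH.
  by move: opa; rewrite aa' opa' => -[].
exact: (match tb in interp _ t b' return
          match t with
          | Var _ => True
          | App f ts => exists2 a' : 'I_(arity f) -> A,
              forall i, interp alpha (ts i) (a' i) & op a' = Some b'
          end
        with
        | interp_Var _ => I
        | interp_App _ _ a' _ tsa' opa' => ex_intro2 _ _ a' tsa' opa'
        end).
Qed.

(* The value of a ground term does not depend on alpha, so [[t]] for ground t is
   [[t]]_alpha for any alpha : X -> A (one exists, A being non-empty). *)
Definition all_defined (T : set (term Sigma X)) : Prop :=
  forall t, T t -> forall alpha : X -> A, exists a, interp alpha t a.

(* [[l]]_alpha and [[r]]_alpha depend only on the restriction of alpha to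
   Var(l), and any Var(l) -> A extends to X -> A, A being non-empty. *)
Definition partial_model (rho : relation A) (R : TRS Sigma X) : Prop :=
  forall rl, R rl -> forall (alpha : X -> A) (a : A),
    interp alpha (lhs rl) a -> exists2 b, interp alpha (rhs rl) b & rho a b.

End Interpretation.

Definition closed_wrt (A : Type) (n : nat) (g : ('I_n -> A) -> option A)
    (rho : relation A) : Prop :=
  forall (a : 'I_n -> A) (i : 'I_n) (b : A),
    rho (a i) b -> g a <> None -> g (upd a i b) <> None.

Definition monotone_wrt (A : Type) (n : nat) (g : ('I_n -> A) -> option A)
    (rho : relation A) : Prop :=
  forall (a : 'I_n -> A) (i : 'I_n) (b c d : A),
    g a = Some c -> g (upd a i b) = Some d -> rho (a i) b -> rho c d.

Definition ext_wf_monotone (Sigma : signature) (A : partial_algebra Sigma)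
    (succ sqge : relation A) : Prop :=
  [/\ forall f : Sigma, closed_wrt (@op _ A f) succ /\ closed_wrt (@op _ A f) sqge,
      forall f : Sigma, monotone_wrt (@op _ A f) succ /\ monotone_wrt (@op _ A f) sqge
    & relatively_terminating_on succ sqge setT].

(* Main.v *)
Require Import Defs.
From mathcomp Require Import all_boot.
From mathcomp Require Import boolp classical_sets.
From Stdlib Require Import Relations.

Set Implicit Arguments.
Unset Strict Implicit.
Unset Printing Implicit Defensive.

Local Open Scope classical_set_scope.

(** If the algebra exists, every rewrite step from a defined term is simulated in
    the algebra, so an infinite relative rewrite sequence from [T] would give an
    infinite relative sequence of values.  Conversely, take the term algebra in
    which [f(t_1, ..., t_n)] is defined only if it is itself relatively
    terminating; the strict order is the [R]-step restricted to relatively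
    terminating terms and the weak order is the [S]-step. *)

(** * Relative termination of abstract relations *)

Section RelativeTermination.
Variables (A : Type).
Implicit Type r : relation A.

Lemma clos_refl_trans_simulation (B : Type) (I : A -> B -> Prop)
    r (r' : relation B) :
  (forall x y a, r x y -> I x a -> exists2 b, I y b & r' a b) ->
  forall x y a, clos_refl_trans A r x y -> I x a ->
    exists2 b, I y b & clos_refl_trans B r' a b.
Proof.
move=> sim x y a xy; elim: xy a => {x y}
  [x y xy|x|x y z _ IHxy _ IHyz] a xa.
- by have [b yb ab] := sim _ _ _ xy xa; exists b => //; exact: rt_step.
- by exists a => //; exact: rt_refl.
- have [b yb ab] := IHxy _ xa; have [c zc bc] := IHyz _ yb.
  by exists c => //; exact: rt_trans ab bc.
Qed.

(** Keeping [I] an arbitrary relation serves two uses: evaluation of terms, which is partial, and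
    the graph of a one-hole context. *)
Lemma relative_step_simulation (B : Type) (I : A -> B -> Prop)
    (r1 r2 : relation A) (r1' r2' : relation B) :
  (forall x y a, r1 x y -> I x a -> exists2 b, I y b & r1' a b) ->
  (forall x y a, r2 x y -> I x a -> exists2 b, I y b & r2' a b) ->
  forall x y a, relative_step r1 r2 x y -> I x a ->
    exists2 b, I y b & relative_step r1' r2' a b.
Proof.
move=> sim1 sim2 x y a [u [v [xu uv vy]]] xa.
have sim2s := clos_refl_trans_simulation sim2.
have [b ub ab] := sim2s _ _ _ xu xa.
have [c vc bc] := sim1 _ _ _ uv ub.
have [d yd cd] := sim2s _ _ _ vy vc.
by exists d => //; exists b, c.
Qed.

Lemma relative_step_prepend (r1 r2 : relation A) x y z :
  clos_refl_trans A r2 x y -> relative_step r1 r2 y z -> relative_step r1 r2 x z.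
Proof.
by move=> xy [b [c [yb bc cz]]]; exists b, c; split=> //; exact: rt_trans xy yb.
Qed.

Lemma relatively_terminating_step (r1 r2 : relation A) x y :
  relatively_terminating_on r1 r2 [set x] -> r1 x y ->
  relatively_terminating_on r1 r2 [set y].
Proof.
move=> termx xy [s [/= s0 step]]; apply: termx.
exists (fun n => if n is m.+1 then s m else x); split=> //= -[|n]; last exact: step.
by exists x, y; rewrite s0; split=> //; exact: rt_refl.
Qed.

Lemma relatively_terminating_weak_step (r1 r2 : relation A) x y :
  relatively_terminating_on r1 r2 [set x] -> r2 x y ->
  relatively_terminating_on r1 r2 [set y].
Proof.
move=> termx xy [s [/= s0 step]]; apply: termx.
(* A weak step alone is no relative step, so [x] replaces [y] at index 0 and the weak step is
   absorbed into the first relative step. *)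
exists (fun n => if n is m.+1 then s m.+1 else x); split=> //= -[|n]; last exact: step.
by apply: relative_step_prepend (step 0); rewrite s0; exact: rt_step.
Qed.

(** The first strict step of an infinite sequence would leave a terminating point [b], yet the rest
    of the sequence yields an infinite one from [b]. *)
Lemma relatively_terminating_restrict (r1 r2 : relation A) :
  relatively_terminating_on
    (fun x y => relatively_terminating_on r1 r2 [set x] /\ r1 x y) r2 setT.
Proof.
move=> [s [_ step]].
have step' n : relative_step r1 r2 (s n) (s n.+1).
  by have [b [c [sb [_ bc] cs]]] := step n; exists b, c.
have [b [c [_ [termb bc] cs]]] := step 0.
apply: termb; exists (fun n => if n is m.+1 then s m.+1 else b).
split=> //= -[|n]; last exact: step'.
by exists b, c; split=> //; exact: rt_refl.
Qed.

End RelativeTermination.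

(** * Simulating rewriting by the values in a partial algebra *)

Section Soundness.
Variables (Sigma : signature) (X : Type) (A : partial_algebra Sigma).
Implicit Types (t u : term Sigma X) (alpha beta : X -> A).

Lemma interp_App_inv alpha f (ts : 'I_(arity f) -> term Sigma X) b :
  interp alpha (App f ts) b ->
  exists2 a : 'I_(arity f) -> A, forall i, interp alpha (ts i) (a i) & op a = Some b.
Proof.
move=> tb.
(* The type of [ts] depends on [f]; putting the index into the return type avoids an equality of
   dependent pairs. *)
exact: (match tb in interp _ t b' return
          match t with
          | Var _ => True
          | App f ts => exists2 a' : 'I_(arity f) -> A,
              forall i, interp alpha (ts i) (a' i) & op a' = Some b'
          end
        with
        | interp_Var _ => I
        | interp_App _ _ a' _ tsa' opa' => ex_intro2 _ _ a' tsa' opa'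
        end).
Qed.

Lemma interp_Var_inv alpha x a : interp alpha (@Var Sigma X x) a -> a = alpha x.
Proof. by move=> h; apply: (interp_functional h); exact: interp_Var. Qed.

Lemma interp_subst alpha beta sigma t a :
  (forall x, vars t x -> interp alpha (sigma x) (beta x)) ->
  interp beta t a -> interp alpha (subst sigma t) a.
Proof.
elim: t a => [x|f ts IH] a def_sigma ta /=.
  by rewrite (interp_Var_inv ta); exact: def_sigma.
have [b tsb opb] := interp_App_inv ta.
by apply: interp_App opb => i; apply: IH => // x xi; apply: def_sigma; exists i.
Qed.

(** Nothing is asked of [beta] where [sigma x] is undefined: a defined value of the instance forces
    [sigma x] to be defined at every variable of [t]. *)
Lemma interp_subst_inv alpha beta sigma t a :
  (forall x b, interp alpha (sigma x) b -> beta x = b) ->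
  interp alpha (subst sigma t) a ->
  interp beta t a /\ (forall x, vars t x -> interp alpha (sigma x) (beta x)).
Proof.
move=> betaE; elim: t a => [x|f ts IH] a /= ta.
  have xa := betaE _ _ ta.
  by split=> [|_ ->]; rewrite -?xa; [exact: interp_Var|rewrite xa].
have [b tsb opb] := interp_App_inv ta.
split=> [|x [i _ xi]]; last exact: (IH _ _ (tsb i)).2.
by apply: interp_App opb => i; exact: (IH _ _ (tsb i)).1.
Qed.

Lemma ex_valuation_subst alpha sigma :
  exists beta, forall x b, @interp _ X A alpha (sigma x) b -> beta x = b.
Proof.
have [a0] := carrier_nonempty A.
suff /choice[beta betaE] : forall x, exists a, forall b,
    interp alpha (sigma x) b -> a = b by exists beta.
move=> x.
have [[a xa]|undef] := pselect (exists a, interp alpha (sigma x) a).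
  by exists a => b; exact: interp_functional.
by exists a0 => b xb; case: undef; exists b.
Qed.

(** At the root the model condition applies to the valuation induced by the substitution, and
    [rhs_vars] keeps the right-hand side defined. Under a context, closedness gives a value to the
    reduct and monotonicity relates the two values. *)
Lemma rewrite_step_interp (rho : relation A) (R : TRS Sigma X) alpha t u a :
  (forall f : Sigma, closed_wrt (@op _ A f) rho) ->
  (forall f : Sigma, monotone_wrt (@op _ A f) rho) ->
  partial_model rho R ->
  rewrite_step R t u -> interp alpha t a -> exists2 b, interp alpha u b & rho a b.
Proof.
move=> closed mono model tu; elim: tu a => {t u} [rl sigma Rrl|f ts i u _ IH] a ta.
  have [beta betaE] := ex_valuation_subst alpha sigma.
  have [la def_sigma] := interp_subst_inv betaE ta.
  have [b rb ab] := model _ Rrl _ _ la.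
  exists b => //; apply: interp_subst rb => x xr; apply: def_sigma; exact: rhs_vars xr.
have [c tsc opc] := interp_App_inv ta.
have [d ud cd] := IH _ (tsc i).
case opd: (op (upd c i d)) => [b|]; last first.
  by case: (closed f c i d cd) => //; rewrite opc.
exists b; last exact: mono opc opd cd.
by apply: interp_App opd => j; rewrite /upd; case: ifP.
Qed.

Lemma relatively_terminating_of_algebra (R S : TRS Sigma X)
    (T : set (term Sigma X)) (succ sqge : relation A) :
  ext_wf_monotone succ sqge -> all_defined A T ->
  partial_model succ R -> partial_model sqge S ->
  relatively_terminating_on (rewrite_step R) (rewrite_step S) T.
Proof.
move=> [closed mono term] defT modR modS [s [Ts0 step]].
have [a0] := carrier_nonempty A; pose alpha := fun _ : X => a0.
have sim := relative_step_simulation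
  (fun t u a => @rewrite_step_interp succ R alpha t u a
     (fun f => (closed f).1) (fun f => (mono f).1) modR)
  (fun t u a => @rewrite_step_interp sqge S alpha t u a
     (fun f => (closed f).2) (fun f => (mono f).2) modS).
have def n : exists a, interp alpha (s n) a.
  elim: n => [|n [a sa]]; first exact: defT.
  by have [b sb _] := sim _ _ _ (step n) sa; exists b.
(* The values are chosen separately for each index; uniqueness of values identifies them with those
   produced by the simulation. *)
have [v sv] := choice def; apply: term; exists v; split=> // n.
have [b sb vb] := sim _ _ _ (step n) (sv n).
by rewrite (interp_functional (sv n.+1) sb).
Qed.

End Soundness.

(** * Completeness: the partial algebra of terms *)

Section TermAlgebra.
Variables (Sigma : signature) (X : Type) (R S : TRS Sigma X).
Implicit Types (t u : term Sigma X).

Definition term_terminating t :=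
  relatively_terminating_on (rewrite_step R) (rewrite_step S) [set t].

Definition term_op (f : Sigma) (ts : 'I_(arity f) -> term Sigma X) :
    option (term Sigma X) :=
  if pselect (term_terminating (App f ts)) then Some (App f ts) else None.

(** The carrier also contains non-terminating terms, hence the restriction on the source. *)
Definition term_succ t u := term_terminating t /\ rewrite_step R t u.

Lemma term_op_Some f (ts : 'I_(arity f) -> term Sigma X) :
  term_terminating (App f ts) -> term_op ts = Some (App f ts).
Proof. by rewrite /term_op; case: pselect. Qed.

Lemma term_op_inv f (ts : 'I_(arity f) -> term Sigma X) t :
  term_op ts = Some t -> t = App f ts /\ term_terminating t.
Proof. by rewrite /term_op; case: pselect => // term [<-]. Qed.

Lemma rewrite_step_upd (Q : TRS Sigma X) f (ts : 'I_(arity f) -> term Sigma X) i t u :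
  rewrite_step Q t u -> rewrite_step Q (App f (upd ts i t)) (App f (upd ts i u)).
Proof.
move=> tu; have -> : upd ts i u = upd (upd ts i t) i u.
  by apply: funext => j; rewrite /upd; case: eqP.
by apply: rewrite_arg; rewrite /upd eqxx.
Qed.

(** Placing an infinite sequence from [ts i] in the context [App f (upd ts i _)] gives one from
    [App f ts]. *)
Lemma term_terminating_arg f (ts : 'I_(arity f) -> term Sigma X) i :
  term_terminating (App f ts) -> term_terminating (ts i).
Proof.
move=> term [s [/= s0 step]]; apply: term.
exists (fun n => App f (upd ts i (s n))); split=> [|n] /=.
  by congr App; apply: funext => j; rewrite /upd s0; case: eqP => [->|].
pose I t u := u = App f (upd ts i t).
have sim Q t u a : rewrite_step Q t u -> I t a -> exists2 b, I u b & rewrite_step Q a b.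
  by move=> tu ->; exists (App f (upd ts i u)) => //; exact: rewrite_step_upd.
by have [_ ->] := relative_step_simulation (sim R) (sim S) (step n) erefl.
Qed.

Lemma subst_ground sigma t : ground t -> subst sigma t = t.
Proof.
rewrite /ground /=; elim: t => [x|f ts IH] /= t0.
  by have : [set x] x by []; rewrite t0.
congr App; apply: funext => i; apply: IH; apply/seteqP; split=> // x xi.
by rewrite -t0; exists i.
Qed.

Hypothesis term_nonempty : inhabited (term Sigma X).

Definition term_algebra := PartialAlgebra term_nonempty (@term_op).

Lemma term_interp (alpha : X -> term_algebra) t :
  term_terminating (subst alpha t) -> interp alpha t (subst alpha t).
Proof.
elim: t => [x|f ts IH] /= term; first exact: interp_Var.
apply: (@interp_App _ _ term_algebra _ _ _ (fun i => subst alpha (ts i))) => [i|];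
  last exact: term_op_Some.
exact: (IH i (term_terminating_arg (i := i) term)).
Qed.

(** A variable may take a non-terminating value; any other term gets its value from [term_op], which
    yields only terminating terms. *)
Lemma term_interp_inv (alpha : X -> term_algebra) t a :
  interp alpha t a -> a = subst alpha t /\ (~ is_var t -> term_terminating a).
Proof.
case=> {t a} [x|f ts a b]; first by split=> // -[]; exists x.
move=> tsa /term_op_inv[-> term]; split=> //=.
congr App; apply: funext => i; elim: (tsa i) => //= g us c d _ IH /term_op_inv[-> _].
by congr App; exact: funext.
Qed.

(** Closedness holds because steps of either system preserve termination. For monotonicity of
    [term_succ], definedness of the operation supplies the termination of the source. *)
Lemma term_ext_wf_monotone :
  ext_wf_monotone (A := term_algebra) term_succ (rewrite_step S).
Proof.
have stepS := relatively_terminating_weak_step (r1 := rewrite_step R) (r2 := rewrite_step S).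
have stepR := relatively_terminating_step (r1 := rewrite_step R) (r2 := rewrite_step S).
have op_def f (a : 'I_(arity f) -> term Sigma X) :
    term_op a <> None -> term_terminating (App f a).
  by case E: (term_op a) => [t|//] _; have [<-] := term_op_inv E.
split=> [f|f|]; last exact: relatively_terminating_restrict.
  split=> a i b.
    move=> [_ ab] /op_def term; rewrite /= term_op_Some //.
    by apply: stepR term _; exact: rewrite_arg.
  move=> ab /op_def term; rewrite /= term_op_Some //.
  by apply: stepS term _; exact: rewrite_arg.
split=> a i b c d /term_op_inv[-> term] /term_op_inv[-> _].
  by move=> [_ ab]; split=> //; exact: rewrite_arg.
by move=> ab; exact: rewrite_arg.
Qed.

Lemma term_all_defined (T : set (term Sigma X)) :
  T `<=` ground -> relatively_terminating_on (rewrite_step R) (rewrite_step S) T ->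
  all_defined term_algebra T.
Proof.
move=> groundT termT t Tt alpha; exists (subst alpha t); apply: term_interp.
rewrite subst_ground; last exact: groundT.
by move=> [s [/= s0 step]]; apply: termT; exists s; rewrite s0.
Qed.

Lemma term_partial_model_succ : partial_model (A := term_algebra) term_succ R.
Proof.
move=> rl Rrl alpha a /term_interp_inv[-> /(_ (@lhs_nvar _ _ rl)) term].
(* A valuation into the term algebra is itself a substitution, so the rule applies at the root; the
   reduct inherits termination and is therefore defined. *)
have step := rewrite_root alpha Rrl; exists (subst alpha (rhs rl)) => //.
by apply: term_interp; exact: relatively_terminating_step term step.
Qed.

Lemma term_partial_model_sqge : partial_model (A := term_algebra) (rewrite_step S) S.
Proof.
move=> rl Srl alpha a /term_interp_inv[-> /(_ (@lhs_nvar _ _ rl)) term].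
have step := rewrite_root alpha Srl; exists (subst alpha (rhs rl)) => //.
by apply: term_interp; exact: relatively_terminating_weak_step term step.
Qed.

End TermAlgebra.

Theorem theorem4p6 (Sigma : signature) (X : Type) (R S : TRS Sigma X)
    (T : set (term Sigma X)) (T_ground : T `<=` ground) :
  relatively_terminating_on (rewrite_step R) (rewrite_step S) T <->
  exists (A : partial_algebra Sigma) (succ sqge : relation A),
    [/\ ext_wf_monotone succ sqge,
        all_defined A T,
        partial_model succ R
      & partial_model sqge S].
Proof.
split=> [termT|[A [succ [sqge [wf defT modR modS]]]]]; last first.
  exact: relatively_terminating_of_algebra wf defT modR modS.
have [ne|empty] := pselect (inhabited (term Sigma X)).
  exists (term_algebra R S ne), (term_succ R S), (rewrite_step S); split.
  - exact: term_ext_wf_monotone.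
  - exact: term_all_defined.
  - exact: term_partial_model_succ.
  - exact: term_partial_model_sqge.
(* Without terms the term algebra would have an empty carrier. *)
have no_term (t : term Sigma X) : False by apply: empty.
exists (@PartialAlgebra Sigma unit (inhabits tt) (fun _ _ => None)),
  (fun _ _ => False), (fun _ _ => False); split.
- split=> [f|f|]; try by split.
  by move=> [s [_ /(_ 0)[b [c []]]]].
- by move=> t; case: (no_term t).
- by move=> rl; case: (no_term (lhs rl)).
- by move=> rl; case: (no_term (lhs rl)).
Qed.
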